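(* Let $d\ge2$ be an integer and $\alpha\in(0,\tfrac12)$ be fixed, let $n\to\infty$ (through integers for which $\alpha n$ is an integer), and let $\epsilon=\epsilon_n>0$ with $\epsilon_n\to0$ satisfy $\epsilon=\omega(d^{-(1-\alpha)n/2})$ and $\epsilon=\omega(d^{-n/4})$. Then $\epsilon$-approximate $(\alpha n)$-uniform states on $n$ qudits of local dimension $d$ can be generated from a one-dimensional random circuit ensemble of depth $L=O(n)$ with vanishingly small failure probability. That is, there exist, for each such $n$, probability distributions $\nu_n$ on one-dimensional quantum circuits on $n$ qudits of depth $L_n=O(n)$ such that $$\mathrm{Prob}_{U\sim\nu_n}\left[\,U|0\rangle^{\otimes n}\text{ is not an }\epsilon_n\text{-approximate }(\alpha n)\text{-uniform state}\,\right]\longrightarrow0\quad(n\to\infty).$$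
   Context: For a pure state $|\psi\rangle\in(\mathbb C^d)^{\otimes n}$ and $S\subseteq[n]=\{1,\dots,n\}$, put $\rho=|\psi\rangle\langle\psi|$, $\rho_S=\mathrm{Tr}_{S^c}\rho$, $d_S=d^{|S|}$. The state is an $\epsilon$-approximate $k$-uniform state if $\mathrm{Tr}\,\rho_S^2\le\frac1{d_S}+\epsilon^2$ for every $S\subseteq[n]$ with $|S|=k$. A one-dimensional circuit of depth $L$ is a product of $L$ layers, each layer being a tensor product of unitary gates acting on disjoint pairs of neighbouring qudits (or single qudits) on a line, without ancillas; a random circuit ensemble is a probability distribution over such circuits. $a_n=\omega(b_n)$ means $a_n/b_n\to\infty$. *)

(* Defs.v *)
From HB Require Import structures.
From mathcomp Require Import all_boot all_order all_algebra.
From mathcomp Require Import spectral.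
From mathcomp Require Import complex.
From mathcomp Require Import all_classical all_reals all_analysis.

Set Implicit Arguments.
Unset Strict Implicit.
Unset Printing Implicit Defensive.

Import Order.TTheory GRing.Theory Num.Theory.
Import numFieldNormedType.Exports.

Local Open Scope ring_scope.
Local Open Scope complex_scope.

(* Computational basis of (C^d)^{⊗n}: one digit per qudit. *)
Definition config (d n : nat) := {ffun 'I_n -> 'I_d}.

Definition restr (d n : nat) (S : {set 'I_n}) (x : config d n) :
    {ffun {i : 'I_n | i \in S} -> 'I_d} :=
  [ffun i => x (val i)].

(* Vectors and operators on the Hilbert space with orthonormal basis T are
   column vectors and matrices indexed by 'I_#|T|, through enum_val. *)
Definition ket0 (R : realType) (d n : nat) : 'cV[R[i]]_#|config d n| :=
  \col_x [forall i, (enum_val x : config d n) i == 0%N :> nat]%:R.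

Definition pure_state (R : realType) (d n : nat)
    (psi : 'cV[R[i]]_#|config d n|) : Prop :=
  (psi^t*)%sesqui *m psi = 1%:M.

Definition density (R : realType) (d n : nat)
    (psi : 'cV[R[i]]_#|config d n|) : 'M[R[i]]_#|config d n| :=
  psi *m (psi^t*)%sesqui.

(* Tr_{S^c}, i.e. the linear extension of
   |x><y| |-> <y_{S^c}|x_{S^c}> |x_S><y_S|. *)
Definition partial_trace (R : realType) (d n : nat) (S : {set 'I_n})
    (rho : 'M[R[i]]_#|config d n|) :
    'M[R[i]]_#|{ffun {i : 'I_n | i \in S} -> 'I_d}| :=
  \matrix_(a, b)
    \sum_(x : config d n | restr S x == enum_val a)
      \sum_(y : config d n | (restr S y == enum_val b)
                             && (restr (~: S) x == restr (~: S) y))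
        rho (enum_rank x) (enum_rank y).

(* The inequality is in R[i], whose order z <= w also requires w - z real. *)
Definition approx_uniform (R : realType) (d n : nat) (eps : R) (k : nat)
    (psi : 'cV[R[i]]_#|config d n|) : Prop :=
  pure_state psi /\
  forall S : {set 'I_n}, #|S| = k ->
    let rhoS := partial_trace S (density psi) in
    \tr (rhoS *m rhoS) <= ((d ^ #|S|)%:R)^-1 + (eps ^+ 2)%:C.

(* Bond b joins the neighbouring sites b and b.+1 of the open line. *)
Definition bond_left (n : nat) (b : 'I_n.-1) : 'I_n :=
  widen_ord (leq_pred n) b.

Lemma bond_right_subproof (n : nat) (b : 'I_n.-1) : (b.+1 < n)%N.
Proof. by rewrite -ltn_predRL. Qed.

Definition bond_right (n : nat) (b : 'I_n.-1) : 'I_n :=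
  Ordinal (bond_right_subproof b).

Definition bond (n : nat) (b : 'I_n.-1) : {set 'I_n} :=
  [set bond_left b; bond_right b].

(* Two-qudit gates act on the bonds in lbonds, single-qudit gates on the sites
   not covered by lbonds; the other gates of the record are not used. *)
Record layer (R : realType) (d n : nat) := Layer {
  lbonds : {set 'I_n.-1};
  lgate2 : 'I_n.-1 -> 'M[R[i]]_(d * d);
  lgate1 : 'I_n -> 'M[R[i]]_d;
  _ : {in lbonds &, forall b b', b != b' -> [disjoint bond b & bond b']};
  _ : forall b, lgate2 b \is unitarymx;
  _ : forall i, lgate1 i \is unitarymx }.

Definition layer_mx (R : realType) (d n : nat) (l : layer R d n) :
    'M[R[i]]_#|config d n| :=
  \matrix_(p, q)
    let x : config d n := enum_val p in
    let y : config d n := enum_val q in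
    (\prod_(b in lbonds l)
       lgate2 l b (mxvec_index (x (bond_left b)) (x (bond_right b)))
                  (mxvec_index (y (bond_left b)) (y (bond_right b)))) *
    \prod_(i | i \notin (\bigcup_(b in lbonds l) bond b)%SET)
       lgate1 l i (x i) (y i).

(* The layer of index 0 is applied first. *)
Definition circuit (R : realType) (d n L : nat) := L.-tuple (layer R d n).

Definition circuit_mx (R : realType) (d n L : nat) (c : circuit R d n L) :
    'M[R[i]]_#|config d n| :=
  foldl (fun U l => layer_mx l *m U) 1%:M c.

Lemma layer1_bonds (n : nat) :
  {in (finset.set0 : {set 'I_n.-1}) &,
    forall b b', b != b' -> [disjoint bond b & bond b']}.
Proof. by move=> b b'; rewrite finset.in_set0. Qed.

Lemma unitarymx1 (C : numClosedFieldType) (m : nat) :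
  (1%:M : 'M[C]_m) \is unitarymx.
Proof. by apply/unitarymxP; rewrite trmx1 map_mx1 mulmx1. Qed.

Definition layer1 (R : realType) (d n : nat) : layer R d n :=
  Layer (@layer1_bonds n) (fun=> unitarymx1 _ _) (fun=> unitarymx1 _ _).

HB.instance Definition _ (R : realType) (d n L : nat) :=
  gen_eqMixin (circuit R d n L).
HB.instance Definition _ (R : realType) (d n L : nat) :=
  gen_choiceMixin (circuit R d n L).
HB.instance Definition _ (R : realType) (d n L : nat) :=
  isPointed.Build (circuit R d n L) [tuple of nseq L (layer1 R d n)].

Local Open Scope classical_set_scope.

(* The real coordinates of a circuit: for each layer, the choice of bonds and
   the real and imaginary parts of the gate entries. *)
Inductive circuit_coord (R : realType) (d n L : nat) :
    (circuit R d n L -> R) -> Prop :=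
| CoordBonds l B : circuit_coord (fun c => (lbonds (tnth c l) == B)%:R)
| CoordRe2 l b i j :
    circuit_coord (fun c => complex.Re (lgate2 (tnth c l) b i j))
| CoordIm2 l b i j :
    circuit_coord (fun c => complex.Im (lgate2 (tnth c l) b i j))
| CoordRe1 l s i j :
    circuit_coord (fun c => complex.Re (lgate1 (tnth c l) s i j))
| CoordIm1 l s i j :
    circuit_coord (fun c => complex.Im (lgate1 (tnth c l) s i j)).

(* Circuits with the coarsest sigma-algebra making all coordinates
   measurable. *)
Definition circuit_cylinder (R : realType) (d n L : nat) :
    set (set (circuit R d n L)) :=
  [set f @^-1` A | f in @circuit_coord R d n L & A in (measurable : set (set R))].

Definition circuit_space (R : realType) (d n L : nat) :=
  g_sigma_algebraType (@circuit_cylinder R d n L).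

Definition ensemble (R : realType) (d n L : nat) :=
  probability (circuit_space R d n L) R.

(* Main.v *)
Require Import Defs.
From HB Require Import structures.
From mathcomp Require Import all_boot all_order all_algebra.
From mathcomp Require Import cyclic separable cyclotomic spectral.
From mathcomp Require Import complex.
From mathcomp Require Import all_classical all_reals all_analysis.
From mathcomp Require Import zify ring lra.

(* A Dirac ensemble suffices, so for each large n one good circuit must be
   found. Consider the states d^(-n/2) \sum_x f(x) |x>, where f is a product of
   N = 14 d^2 n phases zeta^(g_s(z_(n+s)(x))). Here zeta is a primitive fifth
   root of unity, g_s : Z_d -> Z_5, and z is the shift-register sequence that
   starts with the digits of x and goes on by
     z_(n+s) = z_s + r_(s,1) z_(s+1) + ... + r_(s,n-1) z_(s+n-1)  in Z_d.
   Each step of the register can be done by one wire that moves from left to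
   right, and successive steps can be pipelined, so a brickwork circuit of
   depth O(n) prepares the state.

   By the swap formula, the purity on S is the sum over pairs (x, y) of
   d^(-2n) f(x) f(y) conj(f(x') f(y')), where x', y' are x, y with their
   S-parts exchanged. The pairs that agree on S or off S contribute at most
   d^(-|S|) + d^(-(n-|S|)). Let P_S be the sum of the f-products over the other
   pairs. Averaging |P_S|^2 over all r and g gives a sum of 8-point correlations
   of f. Such a correlation is small when the 4 points in f and the 4 points
   in conj f differ as multisets: averaging over g_s kills it unless the two
   multisets of values of z_(n+s) coincide, and, by a character sum over r_s,
   at most a fraction 7/8 of all r_s make them coincide, for all but O(1) of
   the steps s. Only the 2 d^(2n) correlations with equal multisets matter, so
   the average of |P_S|^2 is at most 3 d^(2n). Summing over the at most 2^n
   sets S, some choice of r and g gives |P_S|^2 <= 3 d^(3n) for all S, that is,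
   an excess purity O(d^(-n/2)), which is below eps^2. *)

Set Implicit Arguments.
Unset Strict Implicit.
Unset Printing Implicit Defensive.

Import Order.TTheory GRing.Theory Num.Theory.
Import numFieldNormedType.Exports.

Local Open Scope ring_scope.

(** * Character sums over the shift register *)

Lemma closed_prim_root_exists (C : numClosedFieldType) (m : nat) :
  (0 < m)%N -> exists z : C, m.-primitive_root z.
Proof.
move=> m_gt0; have [rs] := closed_field_poly_normal ('X^m - 1 : {poly C}).
rewrite (monicP (monicXnsubC _ m_gt0)) scale1r => rsE.
have size_rs : size rs = m.
  by apply: succn_inj; rewrite -(size_prod_XsubC rs id) -rsE size_XnsubC.
have uniq_rs : uniq rs.
  by rewrite -separable_prod_XsubC -rsE separable_Xn_sub_1 // pnatr_eq0 -lt0n.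
suff /(has_prim_root m_gt0)/(_ uniq_rs) : all m.-unity_root rs.
  by rewrite size_rs => /(_ (leqnn m))/hasP[z _ zP]; exists z.
by apply/allP => z z_rs; rewrite /root_of_unity rsE root_prod_XsubC.
Qed.

(** Reindexing by the bijection [h] multiplies the sum by [c]. This kills phase averages, character
    sums and the off-diagonal entries in the unitarity of the Fourier matrix. *)
Lemma sum_eigen0 (F : fieldType) (I : finType) (h : I -> I) (c : F)
    (f : I -> F) :
  injective h -> c != 1 -> (forall i, f (h i) = c * f i) -> \sum_i f i = 0.
Proof.
move=> h_inj c_neq1 fh; apply/eqP.
have fE : \sum_i f i = c * \sum_i f i.
  by rewrite {1}(reindex_inj h_inj) mulr_sumr; apply: eq_bigr => i _.
have : (1 - c) * \sum_i f i == 0 by rewrite mulrBl mul1r -fE subrr.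
by rewrite mulf_eq0 subr_eq0 eq_sym (negPf c_neq1).
Qed.

Lemma neq_count_mem (T : eqType) (s t : seq T) :
  ~~ perm_eq s t -> exists x, count_mem x s != count_mem x t.
Proof.
by case/allPn=> x _ /= sx; exists x.
Qed.

Lemma prod_if_count (R : comRingType) (T : eqType) (s : seq T) (y : T) (c : R) :
  \prod_(z <- s) (if z == y then c else 1) = c ^+ count_mem y s.
Proof.
elim: s => [|z s IHs]; first by rewrite big_nil.
by rewrite big_cons IHs /= exprD; case: eqP; rewrite ?expr1 ?expr0.
Qed.

Lemma norm_prim_root (C : numClosedFieldType) (m : nat) (z : C) :
  m.-primitive_root z -> `|z| = 1.
Proof.
move=> zP; apply/eqP; rewrite -(pexpr_eq1 (prim_order_gt0 zP) (normr_ge0 z)).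
by rewrite -normrX (prim_expr_order zP) normr1.
Qed.

Lemma prim_root_conj (C : numClosedFieldType) (m : nat) (z : C) :
  m.-primitive_root z -> z^* = z^-1.
Proof.
by move=> zP; rewrite [RHS]invC_norm (norm_prim_root zP) expr1n invr1 mul1r.
Qed.

Section Register.
Variables (C : numClosedFieldType) (d n : nat).
Local Notation Zd := 'I_d.+2.
Local Notation window := {ffun 'I_n.+1 -> 'I_d.+2}.
Local Notation phases := {ffun 'I_d.+2 -> 'I_5}.

(** The head has coefficient 1, which makes [shift r] invertible for every [r], also when [d.+2] is
    not prime. *)
Definition feature (r x : window) : Zd :=
  x ord0 + \sum_(i | i != ord0) r i * x i.

Definition shift (r x : window) : window :=
  [ffun i : 'I_n.+1 => if (i < n)%N then x (inord i.+1) else feature r x].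

Lemma featureB r x y : feature r (x - y) = feature r x - feature r y.
Proof.
rewrite /feature !ffunE opprD addrACA; congr (_ + _).
rewrite -sumrB; apply: eq_bigr => i _.
by rewrite !ffunE mulrBr.
Qed.

Lemma shiftE r x (i j : 'I_n.+1) : i = j.+1 :> nat -> shift r x j = x i.
Proof.
move=> ij; rewrite ffunE.
have -> : (j < n)%N by have := ltn_ord i; rewrite ij.
by congr (x _); apply/val_inj; rewrite /= inordK -?ij.
Qed.

Lemma shift_max r x : shift r x ord_max = feature r x.
Proof. by rewrite ffunE ltnn. Qed.

Lemma shift_inj r : injective (shift r).
Proof.
move=> x y xy.
have xyS (i : 'I_n.+1) : i != ord0 -> x i = y i.
  rewrite -val_eqE /= -lt0n => i_gt0.
  have ij : i = (inord i.-1 : 'I_n.+1).+1 :> nat.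
    by rewrite inordK prednK // ltnW.
  by rewrite -(shiftE r x ij) xy (shiftE r y ij).
apply/ffunP=> i; have [->|/xyS //] := eqVneq i ord0.
have := shift_max r x; rewrite xy shift_max /feature => /esym.
rewrite (eq_bigr (fun i => r i * y i)); first by move/addIr.
by move=> j j0; rewrite xyS.
Qed.

Section Phases.
Variable zeta : C.
Hypothesis zetaP : 5.-primitive_root zeta.

Fixpoint phase (s : seq (window * phases)) (x : window) : C :=
  if s is (r, g) :: s' then zeta ^+ g (feature r x) * phase s' (shift r x)
  else 1.

Definition correlation (s : seq (window * phases)) (ps qs : seq window) : C :=
  (\prod_(x <- ps) phase s x) * \prod_(x <- qs) (phase s x)^*.

Definition gate_correlation (g : phases) (ps qs : seq Zd) : C :=
  (\prod_(y <- ps) zeta ^+ g y) * \prod_(y <- qs) (zeta ^+ g y)^*.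

Lemma norm_zetaX k : `|zeta ^+ k| = 1.
Proof.
by rewrite normrX (norm_prim_root zetaP) expr1n.
Qed.

Lemma norm_phase s x : `|phase s x| = 1.
Proof.
by elim: s x => [|[r g] s IHs] x /=; rewrite ?normr1 // normrM norm_zetaX IHs mulr1.
Qed.

Lemma norm_gate_correlation g ps qs : `|gate_correlation g ps qs| = 1.
Proof.
rewrite normrM !normr_prod !big1 ?mulr1 // => y _; first by rewrite norm_conjC norm_zetaX.
by rewrite norm_zetaX.
Qed.

Lemma correlation_cons r g s ps qs :
  correlation ((r, g) :: s) ps qs =
  gate_correlation g (map (feature r) ps) (map (feature r) qs) *
  correlation s (map (shift r) ps) (map (shift r) qs).
Proof.
rewrite /correlation /gate_correlation !big_map /= big_split /=.
under [X in _ * X = _]eq_bigr do rewrite rmorphM.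
by rewrite big_split /= mulrACA.
Qed.

(** Raising [g] by 1 at a digit whose multiplicities a in [ps] and b in [qs] differ multiplies the
    correlation by [zeta] to the power a - b. As a and b are below 5, the order of [zeta], this
    factor is not 1. *)
Lemma sum_gate_correlation0 ps qs :
  (size ps < 5)%N -> (size qs < 5)%N -> ~~ perm_eq ps qs ->
  \sum_g gate_correlation g ps qs = 0.
Proof.
move=> ps5 qs5 /neq_count_mem[y pqy].
pose sh (g : phases) : phases :=
  [ffun z => if z == y then (g z : 'Z_5) + 1 else g z].
have sh_inj : injective sh.
  move=> g g' /ffunP gg'; apply/ffunP => z; have := gg' z; rewrite !ffunE.
  by case: eqP => // _ /addIr.
pose c := zeta ^+ count_mem y ps * (zeta^*) ^+ count_mem y qs.
have c_neq1 : c != 1.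
  rewrite /c (prim_root_conj zetaP) exprVn.
  have zq : zeta ^+ count_mem y qs != 0.
    by rewrite expf_neq0 // (prim_root_eq0 zetaP).
  rewrite -(inj_eq (mulIf zq)) mulfVK // mul1r (eq_prim_root_expr zetaP).
  by rewrite !modn_small // (leq_ltn_trans (count_size _ _)).
apply: (sum_eigen0 sh_inj c_neq1) => g.
have zsh z : zeta ^+ sh g z = (if z == y then zeta else 1) * zeta ^+ g z.
  rewrite ffunE; case: eqP => _; last by rewrite mul1r.
  by rewrite /= addn1 (prim_expr_mod zetaP) exprS.
rewrite /gate_correlation; under eq_bigr do rewrite zsh.
under [X in _ * X]eq_bigr do rewrite zsh rmorphM.
rewrite !big_split /= prod_if_count.
under [X in _ * (X * _)]eq_bigr do rewrite (fun_if Num.conj) rmorph1.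
by rewrite prod_if_count mulrACA.
Qed.

End Phases.

Section Detection.
Variable w : C.
Hypothesis wP : d.+2.-primitive_root w.

Lemma prim_exprD (a b : Zd) : w ^+ (a + b)%R = w ^+ a * w ^+ b.
Proof. by rewrite /= (prim_expr_mod wP) exprD. Qed.

(** If [v i] is nonzero for some [i] off the head, adding the unit vector at [i] to [r] multiplies
    the summand by [w ^+ v i], which is not 1. *)
Lemma sum_char_feature (v : window) :
  \sum_r w ^+ feature r v =
  if [forall i, (i != ord0) ==> (v i == 0)] then w ^+ v ord0 *+ #|{: window}|
  else 0.
Proof.
case: ifPn => [/forallP v0 | /forallPn[ i ]].
  rewrite -sumr_const; apply: eq_bigr => r _.
  rewrite /feature big1 ?addr0 // => i i0.
  by have := v0 i; rewrite i0 /= => /eqP ->; rewrite mulr0.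
rewrite negb_imply => /andP[i0 vi].
pose delta : window := [ffun j => (j == i)%:R].
have featD r : feature (r + delta) v = v i + feature r v.
  rewrite /feature addrCA; congr (_ + _).
  under eq_bigr do rewrite ffunE mulrDl; rewrite big_split /= addrC; congr (_ + _).
  rewrite (bigD1 i) //= big1 ?addr0 => [|j /andP[_ /negPf ji]].
    by rewrite ffunE eqxx mul1r.
  by rewrite ffunE ji mul0r.
have c_neq1 : w ^+ v i != 1.
  rewrite -(prim_order_dvd wP) gtnNdvd // lt0n.
  by apply: contraNneq vi => vi; apply/eqP/val_inj.
apply: (sum_eigen0 (addIr delta) c_neq1) => r.
by rewrite featD prim_exprD.
Qed.

(** The difference [D r] of two character sums vanishes when the feature multisets agree, and its
    modulus is at most [size ps + size qs] otherwise. Summed over [r], only the copies of [x0]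
    survive, since no other point differs from [x0] at the head alone; their multiplicities differ
    by at least 1, so the total is at least the number of windows. *)
Lemma feature_detects (ps qs : seq window) (x0 : window) :
  count_mem x0 ps != count_mem x0 qs ->
  {in ps ++ qs, forall x : window,
    (forall i, i != ord0 -> x i = x0 i) -> x = x0} ->
  (#|{: window}| <= (size ps + size qs) *
     #|[set r | ~~ perm_eq (map (feature r) ps) (map (feature r) qs)]|)%N.
Proof.
move=> x0pq isolated.
pose D r := \sum_(x <- ps) w ^+ feature r (x - x0) -
            \sum_(x <- qs) w ^+ feature r (x - x0).
have sumE (s : seq window) : {subset s <= ps ++ qs} ->
    \sum_r \sum_(x <- s) w ^+ feature r (x - x0) =
    (#|{: window}| * count_mem x0 s)%:R.
  move=> sub_s; rewrite exchange_big /= -sum1_count big_distrr /= natr_sum.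
  rewrite [RHS]big_mkcond big_seq [RHS]big_seq; apply: eq_bigr => x xs.
  rewrite sum_char_feature muln1; case: (eqVneq x x0) => [->|xx0].
    rewrite subrr ffunE expr0 ifT //.
    by apply/forallP => i; rewrite ffunE eqxx implybT.
  rewrite ifN //; apply: contra xx0 => /forallP x_x0; apply/eqP.
  apply: isolated => [|i i0]; first exact: sub_s.
  by have := x_x0 i; rewrite i0 !ffunE subr_eq0 => /eqP.
have sumD : \sum_r D r = #|{: window}|%:R *
    ((count_mem x0 ps)%:R - (count_mem x0 qs)%:R).
  rewrite /D sumrB !sumE ?natrM ?mulrBr // => x; rewrite mem_cat => ->.
    by rewrite orbT.
  by [].
have Dle r : `|D r| <= ((size ps + size qs) *
    (~~ perm_eq (map (feature r) ps) (map (feature r) qs)))%:R.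
  case: (boolP (perm_eq _ _)) => [pq|_] /=.
    have -> : D r = 0; last by rewrite normr0 ler0n.
    apply/eqP; rewrite /D subr_eq0; apply/eqP.
    under eq_bigr do rewrite featureB.
    under [RHS]eq_bigr do rewrite featureB.
    rewrite -!(big_map (feature r) xpredT (fun y => w ^+ (y - feature r x0)%R)).
    exact: perm_big.
  have nw (s : seq window) : `|\sum_(x <- s) w ^+ feature r (x - x0)| <= (size s)%:R.
    apply: (le_trans (ler_norm_sum _ _ _)); rewrite -sum1_size natr_sum.
    by apply: ler_sum => x _; rewrite normrX (norm_prim_root wP) expr1n.
  rewrite muln1 natrD (le_trans (ler_normB _ _)) // lerD //; exact: nw.
have := ler_norm_sum (index_enum _) D xpredT.
rewrite sumD normrM normr_nat => /le_trans/(_ (ler_sum _ (fun r _ => Dle r))).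
rewrite -natr_sum -big_distrr /= => le_sum.
have -> : #|[set r | ~~ perm_eq (map (feature r) ps) (map (feature r) qs)]| =
    (\sum_r ~~ perm_eq (map (feature r) ps) (map (feature r) qs))%N.
  by rewrite -sum1dep_card big_mkcond; apply: eq_bigr => r _; case: perm_eq.
rewrite -(ler_nat C); apply: le_trans le_sum.
rewrite ler_peMr ?ler0n //.
have [pq|qp|] := ltngtP (count_mem x0 qs) (count_mem x0 ps).
- rewrite -natrB 1?ltnW // normr_nat ler1n subn_gt0 //.
- by rewrite distrC -natrB 1?ltnW // normr_nat ler1n subn_gt0.
- by move=> E; rewrite E eqxx in x0pq.
Qed.

End Detection.
End Register.

(** * Decay of averaged correlations *)

Section Average.
Variables (C : numFieldType) (X : finType).

(** The recursion peels off the first entry, as [phase] does, so that the first register step can be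
    averaged separately. *)
Fixpoint avg (N : nat) (G : seq X -> C) : C :=
  if N is N'.+1 then #|X|%:R^-1 * \sum_x avg N' (fun s => G (x :: s))
  else G [::].

Lemma eq_avg N (G G' : seq X -> C) : G =1 G' -> avg N G = avg N G'.
Proof.
elim: N G G' => [|N IHN] G G' GG' /=; first exact: GG'.
by congr (_ * _); apply: eq_bigr => x _; apply: IHN => s; apply: GG'.
Qed.

Lemma avg_sum N (I : finType) (P : pred I) (G : I -> seq X -> C) :
  avg N (fun s => \sum_(i | P i) G i s) = \sum_(i | P i) avg N (G i).
Proof.
elim: N G => [|N IHN] G //=.
rewrite -mulr_sumr [in RHS]exchange_big /=.
by rewrite (eq_bigr _ (fun x _ => IHN _)).
Qed.

Lemma avgZ N (c : C) (G : seq X -> C) :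
  avg N (fun s => c * G s) = c * avg N G.
Proof.
elim: N G => [|N IHN] G //=.
rewrite [RHS]mulrCA [in RHS]mulr_sumr; congr (_ * _).
by apply: eq_bigr => x _; apply: IHN.
Qed.

Lemma norm_avg_le1 N (G : seq X -> C) :
  (forall s, `|G s| <= 1) -> `|avg N G| <= 1.
Proof.
elim: N G => [|N IHN] G G1 /=; first exact: G1.
(* For an empty [X] the average is 0, since [0^-1] is 0. *)
rewrite normrM normfV normr_nat; have [->|X0] := eqVneq (#|X|%:R : C) 0.
  by rewrite invr0 mul0r.
rewrite ler_pdivrMl ?lt0r ?X0 ?ler0n // mulr1 (le_trans (ler_norm_sum _ _ _)) //.
by rewrite -sum1_card natr_sum ler_sum // => x _; apply: IHN => s; apply: G1.
Qed.

Lemma avg_ge0 N (G : seq X -> C) : (forall s, 0 <= G s) -> 0 <= avg N G.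
Proof.
elim: N G => [|N IHN] G G0 /=; first exact: G0.
by rewrite mulr_ge0 ?invr_ge0 ?ler0n // sumr_ge0 // => y _; apply: IHN.
Qed.

(** Entries are fixed one at a time, each keeping the average over the rest at most [b]. If no entry
    did, all these averages, being real like [b], would exceed [b], and so would their mean. *)
Lemma exists_le_avg N (G : seq X -> C) (b : C) :
  (0 < #|X|)%N -> b \is Num.real -> (forall s, 0 <= G s) -> avg N G <= b ->
  exists2 s, size s = N & G s <= b.
Proof.
move=> X_gt0 b_real; elim: N G => [|N IHN] G G0 /=; first by exists [::].
rewrite ler_pdivrMl ?ltr0n // => sum_le.
have [/existsP[x avg_le] | /existsPn avg_gt] :=
    boolP [exists x, avg N (fun s => G (x :: s)) <= b].
  by have [s <- Gs] := IHN _ (fun s => G0 (x :: s)) avg_le; exists (x :: s).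
suff : #|X|%:R * b < \sum_x avg N (fun s => G (x :: s)).
  by move/lt_le_trans/(_ sum_le); rewrite ltxx.
rewrite mulr_natl -sumr_const; apply: ltr_sum => [|x _].
  by have /card_gt0P[x _] := X_gt0; apply/hasP; exists x; rewrite ?mem_index_enum.
by rewrite real_ltNge ?avg_gt // ger0_real // avg_ge0.
Qed.

End Average.

Section Decay.
Variables (C : numClosedFieldType) (d n : nat) (zeta : C).
Hypothesis zetaP : 5.-primitive_root zeta.
Local Notation window := {ffun 'I_n.+1 -> 'I_d.+2}.
Local Notation phases := {ffun 'I_d.+2 -> 'I_5}.

(* A step of the register is uninformative when some point of the correlation
   differs from [x0] at the head of the window only; the next such step for
   the same point is at least [n.+1] steps later. [stalls N (last_diff x0 x)]
   bounds the number of uninformative steps caused by [x] among the next [N]. *)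
Definition last_diff (x0 x : window) : nat :=
  \max_(i | x i != x0 i) (i : nat).

Definition stalls (N l : nat) : nat := ((N + n - l) %/ n.+1)%N.

Lemma last_diff_le x0 x : (last_diff x0 x <= n)%N.
Proof. by apply/bigmax_leqP => i _; rewrite -ltnS. Qed.

(** Digits move one place towards the head, so the last difference retreats by at most one place. *)
Lemma last_diff_shift (r x0 x : window) :
  (last_diff x0 x <= (last_diff (shift r x0) (shift r x)).+1)%N.
Proof.
apply/bigmax_leqP => i xi; case: (posnP i) => [->//|i_gt0].
have ij : i = (inord i.-1 : 'I_n.+1).+1 :> nat by rewrite inordK prednK // ltnW.
rewrite {1}ij ltnS leq_bigmax_cond //.
by rewrite (shiftE r x ij) (shiftE r x0 ij).
Qed.

(** The features differ by exactly the difference of the heads, so the disagreement lost at the head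
    reappears at the end of the window. *)
Lemma last_diff_head (r x0 x : window) :
  x != x0 -> (forall i, i != ord0 -> x i = x0 i) ->
  last_diff x0 x = 0%N /\ last_diff (shift r x0) (shift r x) = n.
Proof.
move=> xx0 xE; split.
  apply/eqP; rewrite -leqn0; apply/bigmax_leqP => i.
  by case: (eqVneq i ord0) => [-> //|/xE ->]; rewrite eqxx.
apply/eqP; rewrite eqn_leq last_diff_le /=.
rewrite -[n in (n <= _)%N]/(val (@ord_max n)) leq_bigmax_cond //.
apply: contra xx0; rewrite !shift_max /feature.
rewrite (eq_bigr (fun i => r i * x0 i)) => [/eqP/addIr x0E|i /xE -> //].
by apply/eqP/ffunP => i; case: (eqVneq i ord0) => [->|/xE].
Qed.

Lemma stallsS N l l' :
  (l <= n)%N -> (l <= l'.+1)%N -> (stalls N l' <= stalls N.+1 l)%N.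
Proof. by move=> ln ll'; rewrite /stalls leq_div2r //; lia. Qed.

Lemma stallsS0 N : (stalls N.+1 0 = (stalls N n).+1)%N.
Proof.
by rewrite /stalls addnK subn0 addSnnS divnDr // divnn addn1.
Qed.

Lemma norm_correlation (s : seq (window * phases)) ps qs :
  `|correlation zeta s ps qs| = 1.
Proof.
rewrite normrM !normr_prod !big1 ?mulr1 // => x _.
  by rewrite norm_conjC norm_phase.
by rewrite norm_phase.
Qed.

(** Induction on [N], splitting off the first step. An uninformative step is paid for by a drop of
    the stall count; any other step gains a factor 7/8 by [feature_detects]. Shifts are injective,
    so the multiplicities of [x0] stay different. *)
Lemma avg_correlation_decay N (ps qs : seq window) (x0 : window) :
  (size ps < 5)%N -> (size qs < 5)%N -> count_mem x0 ps != count_mem x0 qs ->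
  `|avg N (fun s => correlation zeta s ps qs)| <=
  (7 / 8) ^+ (N - \sum_(x <- ps ++ qs | x != x0) stalls N (last_diff x0 x)).
Proof.
have th_ge0 : 0 <= 7 / 8 :> C by rewrite divr_ge0 ?ler0n.
have th_le1 : 7 / 8 <= 1 :> C by rewrite ler_pdivrMr ?ltr0n // mul1r ler_nat.
have th_mono i j : (i <= j)%N -> (7 / 8) ^+ j <= (7 / 8) ^+ i :> C.
  exact: ler_wiXn2l.
elim: N ps qs x0 => [|N IHN] ps qs x0 ps5 qs5 x0pq.
  by rewrite norm_correlation sub0n expr0.
set B := (\sum_(x <- _ | _) _)%N.
pose B' r := (\sum_(x <- ps ++ qs | x != x0)
  stalls N (last_diff (shift r x0) (shift r x)))%N.
pose A r := avg N (fun s =>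
  correlation zeta s (map (shift r) ps) (map (shift r) qs)).
have A_le r : `|A r| <= (7 / 8) ^+ (N - B' r).
  have := IHN (map (shift r) ps) (map (shift r) qs) (shift r x0).
  rewrite !size_map -map_cat big_map => /(_ ps5 qs5).
  have countE s : count_mem (shift r x0) (map (shift r) s) = count_mem x0 s.
    by rewrite count_map; apply: eq_count => x /=; rewrite (inj_eq (@shift_inj _ _ r)).
  rewrite !countE => /(_ x0pq); congr (_ <= _ ^+ (N - _)).
  by apply: eq_bigl => x; rewrite (inj_eq (@shift_inj _ _ r)).
pose K r := perm_eq (map (feature r) ps) (map (feature r) qs).
have avg_le : `|avg N.+1 (fun s => correlation zeta s ps qs)| <=
    #|{: window}|%:R^-1 * \sum_r (K r)%:R * (7 / 8) ^+ (N - B' r).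
  (* Only the first gate depends on [g]; its sum over [g] factors out and vanishes unless the
     feature multisets agree. *)
  have -> : avg N.+1 (fun s => correlation zeta s ps qs) =
      #|{: window * phases}|%:R^-1 * \sum_r (\sum_g
        gate_correlation zeta g (map (feature r) ps) (map (feature r) qs)) * A r.
    rewrite [LHS]/=; congr (_ * _).
    under [RHS]eq_bigr do rewrite mulr_suml.
    rewrite pair_bigA; apply: eq_bigr => -[r g] _ /=.
    by rewrite -avgZ; apply: eq_avg => s; rewrite correlation_cons.
  rewrite card_prod natrM invfM -mulrA normrM normfV normr_nat.
  rewrite ler_wpM2l ?invr_ge0 ?ler0n // normrM normfV normr_nat.
  rewrite ler_pdivrMl; last first.
    by rewrite ltr0n; apply/card_gt0P; exists [ffun=> ord0].
  rewrite (le_trans (ler_norm_sum _ _ _)) // mulr_sumr ler_sum // => r _.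
  rewrite normrM mulrA ler_pM //; have [Kr|Kr] := boolP (K r).
    rewrite mulr1 (le_trans (ler_norm_sum _ _ _)) // -sum1_card natr_sum.
    by rewrite ler_sum // => g _; rewrite norm_gate_correlation.
  by rewrite sum_gate_correlation0 ?size_map // normr0 mulr0.
apply: le_trans avg_le _.
have W_gt0 : (0 < #|{: window}|)%N by apply/card_gt0P; exists [ffun=> ord0].
have le_stalls r x : (stalls N (last_diff (shift r x0) (shift r x)) <=
    stalls N.+1 (last_diff x0 x))%N.
  by apply: stallsS; [exact: last_diff_le | exact: last_diff_shift].
rewrite ler_pdivrMl ?ltr0n //.
pose bad x := (x != x0) && [forall i, (i != ord0) ==> (x i == x0 i)].
have [/hasP[x xpq /andP[xx0 /forallP xE]] | /hasPn good] := boolP (has bad (ps ++ qs)).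
  have headE i : i != ord0 -> x i = x0 i.
    by move=> i0; have := xE i; rewrite i0 => /eqP.
  (* The point [x] uses up one stall by [stallsS0], and no other point gains any. *)
  have B'lt r : (B' r < B)%N.
    rewrite /B' /B (big_rem x) //= [X in (_ < X)%N](big_rem x) //= xx0.
    have [-> ->] := last_diff_head r xx0 headE; rewrite stallsS0 addSn ltnS.
    by rewrite leq_add2l; apply: leq_sum => y _; apply: le_stalls.
  rewrite [leRHS]mulr_natl -[leRHS]sumr_const ler_sum // => r _.
  rewrite -[leRHS]mul1r ler_pM ?ler0n ?exprn_ge0 ?lern1 ?leq_b1 //.
  by apply: th_mono; have := B'lt r; lia.
have B'le r : (B' r <= B)%N by apply: leq_sum => x _; apply: le_stalls.
(* With at most 4 + 4 points, the features separate [ps] from [qs] for at least one eighth of all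
   [r]. *)
have Kcount : (8 * \sum_r K r <= 7 * #|{: window}|)%N.
  have [w wP] := closed_prim_root_exists C (ltn0Sn d.+1).
  have : (#|{: window}| <= (size ps + size qs) * #|[set r | ~~ K r]|)%N.
    apply: (feature_detects wP x0pq) => x xpq xE.
    apply/eqP; apply: contraT => xx0; have := good x xpq.
    rewrite /bad xx0 => /forallPn[ i ]; rewrite negb_imply => /andP[i0].
    by rewrite xE // eqxx.
  have -> : #|[set r | ~~ K r]| = (#|{: window}| - \sum_r K r)%N.
    rewrite -sum1dep_card big_mkcond /= -sum1_card -sumnB; last by move=> r _; case: (K r).
    by apply: eq_bigr => r _; case: (K r).
  have : (\sum_r K r <= #|{: window}|)%N.
    by rewrite -sum1_card leq_sum // => r _; case: (K r).
  have : (size ps + size qs <= 8)%N by lia.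
  move: (size ps + size qs)%N (\sum_r K r)%N #|_| => m a b; nia.
apply: (@le_trans _ _ (\sum_r (K r)%:R * (7 / 8) ^+ (N - B))).
  by rewrite ler_sum // => r _; rewrite ler_wpM2l ?ler0n // th_mono // leq_sub2l.
rewrite -mulr_suml -natr_sum.
apply: (@le_trans _ _ (#|{: window}|%:R * (7 / 8) ^+ (N - B).+1)).
  rewrite exprS mulrA ler_wpM2r ?exprn_ge0 //.
  by rewrite mulrA ler_pdivlMr ?ltr0n // -!natrM ler_nat mulnC [leqRHS]mulnC.
by rewrite ler_wpM2l ?ler0n // th_mono //; lia.
Qed.

End Decay.

(** * Second moment of the off-diagonal purity *)

Section Swap.
Variables (C : numClosedFieldType) (T : finType) (n : nat).
Local Notation window := {ffun 'I_n -> T}.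

Definition swap_on (S : {set 'I_n}) (x y : window) : window :=
  [ffun i => if i \in S then y i else x i].

(** Pairs that differ both on [S] and off [S]: the swap returns the first point if they agree on
    [S], and the second if they agree off [S]. *)
Definition generic_pair (S : {set 'I_n}) : pred (window * window) :=
  fun p => (swap_on S p.1 p.2 != p.1) && (swap_on S p.1 p.2 != p.2).

Definition swap_term (f : window -> C) (S : {set 'I_n})
    (p : window * window) : C :=
  f p.1 * f p.2 * (f (swap_on S p.1 p.2))^* * (f (swap_on S p.2 p.1))^*.

Definition offdiag (f : window -> C) (S : {set 'I_n}) : C :=
  \sum_(p | generic_pair S p) swap_term f S p.

Lemma generic_pair_neq S x y :
  generic_pair S (x, y) ->
  [/\ x != y, x != swap_on S x y, x != swap_on S y x, y != swap_on S x y &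
      y != swap_on S y x].
Proof.
rewrite /generic_pair /= => /andP[neqx neqy]; split.
- by apply: contra neqx => /eqP ->; apply/eqP/ffunP => i; rewrite ffunE if_same.
- by rewrite eq_sym.
- apply: contra neqy => /eqP/ffunP yx; apply/eqP/ffunP => i.
  by have := yx i; rewrite !ffunE; case: (i \in S).
- by rewrite eq_sym.
- apply: contra neqx => /eqP/ffunP yx; apply/eqP/ffunP => i.
  by have := yx i; rewrite !ffunE; case: (i \in S).
Qed.

End Swap.

Section Purity.
Variables (C : numClosedFieldType) (d n : nat).
Local Notation window := {ffun 'I_n.+1 -> 'I_d.+2}.

Section Moment.
Variable zeta : C.
Hypothesis zetaP : 5.-primitive_root zeta.

Let D : C := #|{: window}|%:R.

(** The square expands into correlations indexed by two generic pairs [p], [q]. The points of [p]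
    differ from its swapped points, so equal multisets force [q] to be [p] or its transpose: at most
    two terms of modulus at most 1 for each [p]. The other [q] add at most [kappa * D ^+ 2 <= 1]. *)
Lemma offdiag_moment (N : nat) (S : {set 'I_n.+1}) (kappa : C) :
  (forall ps qs (x0 : window), size ps = 4 -> size qs = 4 ->
    (7 / 8) ^+ (N - \sum_(x <- ps ++ qs | x != x0) stalls n N (last_diff x0 x))
    <= kappa) ->
  kappa * D ^+ 2 <= 1 ->
  avg N (fun s => `|offdiag (phase (d := d) zeta s) S| ^+ 2) <= 3 * D ^+ 2.
Proof.
move=> decay kappa_le.
pose ps (p q : window * window) :=
  [:: p.1; p.2; swap_on S q.1 q.2; swap_on S q.2 q.1].
have sqE s : `|offdiag (phase (d := d) zeta s) S| ^+ 2 =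
    \sum_(p | generic_pair S p) \sum_(q | generic_pair S q)
      correlation zeta s (ps p q) (ps q p).
  rewrite normCK rmorph_sum mulr_suml; apply: eq_bigr => p _.
  rewrite mulr_sumr; apply: eq_bigr => q _.
  rewrite /correlation /swap_term !big_cons !big_nil !rmorphM /= !conjCK.
  ring.
have avgE : avg N (fun s => `|offdiag (phase (d := d) zeta s) S| ^+ 2) =
    \sum_(p | generic_pair S p) \sum_(q | generic_pair S q)
      avg N (fun s => correlation zeta s (ps p q) (ps q p)).
  by rewrite (eq_avg _ sqE) avg_sum; apply: eq_bigr => p _; apply: avg_sum.
rewrite -[leLHS]ger0_norm ?avgE; last first.
  by rewrite -avgE avg_ge0 // => s; rewrite exprn_ge0.
have card_pairs : #|{: window * window}|%:R = D ^+ 2 :> C.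
  by rewrite card_prod natrM.
rewrite (le_trans (ler_norm_sum _ _ _)) // big_mkcond /=.
rewrite -card_pairs mulr_natr -sumr_const ler_sum // => p _.
case: ifP => // gp.
rewrite (le_trans (ler_norm_sum _ _ _)) // big_mkcond /=.
apply: (@le_trans _ _ (\sum_q
    ((q \in [set p; (p.2, p.1)])%:R + kappa))); last first.
  rewrite big_split /= sumr_const -[kappa *+ _]mulr_natr card_pairs.
  have -> : \sum_q (q \in [set p; (p.2, p.1)])%:R =
      #|[set p; (p.2, p.1)]|%:R :> C.
    rewrite -sum1_card natr_sum [RHS]big_mkcond.
    by apply: eq_bigr => q _; case: (q \in _).
  by rewrite [leRHS](natrD _ 2 1) lerD // ler_nat cards2; case: eqP.
have kappa_ge0 : 0 <= kappa.
  by apply: le_trans (decay (nseq 4 p.1) (nseq 4 p.1) p.1 _ _).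
apply: ler_sum => q _; case: ifP => // gq; last by rewrite addr_ge0 ?ler0n.
have [pq|/neq_count_mem[x0 x0pq]] := boolP (perm_eq (ps p q) (ps q p)); last first.
  rewrite ler_wpDl ?ler0n // (le_trans (avg_correlation_decay _ _ _ _ x0pq)) //.
  exact: decay.
have -> : q \in [set p; (p.2, p.1)].
  case: p gp pq => x y /generic_pair_neq[xy x1 x2 y1 y2].
  case: q gq => x' y' gq pq.
  have := perm_mem pq x; have := perm_mem pq y.
  rewrite !inE /= !eqxx !orbT /= (negPf x1) (negPf x2) (negPf y1) (negPf y2).
  rewrite !orbF.
  move=> /esym/orP yq /esym/orP xq; rewrite !xpair_eqE.
  case: xq yq => /eqP Ex [] /eqP Ey; move: xy; rewrite Ex Ey ?eqxx ?orbT //.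
rewrite ler_wpDr // norm_avg_le1 // => s.
by rewrite norm_correlation.
Qed.

End Moment.

(** Bernoulli's inequality for 8/7. With [m] the squared local dimension, [7 * m] decay steps yield
    a factor below 1/m. *)
Lemma bernoulli_pow (m : nat) : (m.+1 * 7 ^ (7 * m) <= 8 ^ (7 * m))%N.
Proof.
have H k : ((7 + k) * 7 ^ k <= 7 * 8 ^ k)%N.
  elim: k => [|k IHk] //; rewrite !expnS; move: (7 ^ k)%N (8 ^ k)%N IHk => a b; nia.
have := H (7 * m)%N.
by rewrite -[X in (X + _)%N]muln1 -mulnDr -mulnA leq_pmul2l // add1n.
Qed.

Lemma stalls_le c l : (stalls n (c * n.+1) l <= c)%N.
Proof.
rewrite /stalls -ltnS ltn_divLR //; have := leq_subr l (c * n.+1 + n).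
by rewrite mulSn; lia.
Qed.

Lemma exists_small_offdiag (zeta : C) :
  5.-primitive_root zeta -> (16 <= n.+1)%N ->
  exists2 s, size s = (14 * d.+2 ^ 2 * n.+1)%N &
    forall S : {set 'I_n.+1}, `|offdiag (phase (d := d) zeta s) S| ^+ 2 <= 3 * ((d.+2 ^ n.+1)%:R) ^+ 3.
Proof.
(* Eight points stall at most [c] times each, and [8 * c] is at most half of [N] because
   [16 <= n.+1]. The other half, [7 * d.+2 ^ 2 * n.+1] steps, brings the decay down to [D ^- 2]. *)
move=> zetaP n16; set c := (14 * d.+2 ^ 2)%N; set N := (c * n.+1)%N.
have cardW : #|{: window}| = (d.+2 ^ n.+1)%N by rewrite card_ffun !card_ord.
pose D : C := (d.+2 ^ n.+1)%:R.
have D_gt0 : 0 < D by rewrite ltr0n expn_gt0.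
have decay ps qs (x0 : window) : size ps = 4 -> size qs = 4 ->
    (7 / 8) ^+ (N - \sum_(x <- ps ++ qs | x != x0) stalls n N (last_diff x0 x))
    <= D ^- 2.
  move=> ps4 qs4.
  have le_half : (7 * d.+2 ^ 2 * n.+1 <=
      N - \sum_(x <- ps ++ qs | x != x0) stalls n N (last_diff x0 x))%N.
    have : (\sum_(x <- ps ++ qs | x != x0) stalls n N (last_diff x0 x) <= 8 * c)%N.
      rewrite big_mkcond /= (@leq_trans (\sum_(x <- ps ++ qs) c)%N) //.
        by apply: leq_sum => x _; case: ifP => // _; apply: stalls_le.
      by rewrite big_const_seq count_predT size_cat ps4 qs4 iter_addn_0 mulnC.
    move: (\sum_(_ <- _ | _) _)%N => B; rewrite /N /c.
    move: (d.+2 ^ 2)%N => q; nia.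
  apply: (@le_trans _ _ ((7 / 8) ^+ (7 * d.+2 ^ 2 * n.+1))).
    by rewrite ler_wiXn2l ?divr_ge0 ?ler0n // ler_pdivrMr ?ltr0n // mul1r ler_nat.
  have -> : D ^- 2 = (d.+2%:R ^- 2) ^+ n.+1.
    by rewrite exprVn /D natrX -!exprM mulnC.
  rewrite exprM lerXn2r //.
  - by rewrite nnegrE exprn_ge0 // divr_ge0 ?ler0n.
  - by rewrite nnegrE invr_ge0 exprn_ge0 ?ler0n.
  rewrite expr_div_n ler_pdivrMr ?exprn_gt0 ?ltr0n // mulrC.
  rewrite ler_pdivlMr ?exprn_gt0 ?ltr0n // -!natrX -natrM ler_nat.
  by rewrite mulnC (leq_trans _ (bernoulli_pow _)) // leq_mul2r leqnSn orbT.
have [||//||s sN sS] := @exists_le_avg C _ N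
    (fun s => \sum_(S : {set 'I_n.+1}) `|offdiag (phase (d := d) zeta s) S| ^+ 2) (3 * D ^+ 3).
- by apply/card_gt0P; exists ([ffun=> ord0], [ffun=> ord0]).
- by rewrite ger0_real // mulr_ge0 ?ler0n // exprn_ge0 // ltW.
- by move=> s; apply: sumr_ge0 => S _; rewrite exprn_ge0.
- rewrite avg_sum (@le_trans _ _ (\sum_(S : {set 'I_n.+1}) 3 * D ^+ 2)) //.
    apply: ler_sum => S _; have := offdiag_moment zetaP S decay; rewrite cardW; apply.
    by rewrite mulVf // expf_neq0 // gt_eqF.
  rewrite sumr_const -[leLHS]mulr_natr [D ^+ 3]exprSr [leRHS]mulrA.
  rewrite ler_wpM2l ?mulr_ge0 ?ler0n ?exprn_ge0 ?(ltW D_gt0) //.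
  (* The [2 ^ n.+1] sets cost at most a factor [D], the local dimension being at least 2. *)
  by rewrite -cardsT -powersetT card_powerset cardsT card_ord ler_nat leq_exp2r.
exists s => // S; apply: le_trans sS; rewrite (bigD1 S) //= lerDl.
by apply: sumr_ge0 => S' _; rewrite exprn_ge0.
Qed.

End Purity.

(** * Purity of flat states *)

Section FlatSum.
Variables (C : numClosedFieldType) (d n : nat).
Local Notation config := {ffun 'I_n -> 'I_d}.

Lemma swap_onP (S : {set 'I_n}) (x y : config) :
  reflect {in S, forall i, y i = x i} (swap_on S x y == x).
Proof.
apply: (iffP eqP) => [/ffunP xy i iS | xy].
  by have := xy i; rewrite ffunE iS.
by apply/ffunP => i; rewrite ffunE; case: ifP => // /xy.
Qed.

Lemma swap_onC (S : {set 'I_n}) (x y : config) :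
  swap_on S x y = swap_on (~: S) y x.
Proof. by apply/ffunP => i; rewrite !ffunE finset.in_setC; case: (i \in S). Qed.

Lemma card_agree (S : {set 'I_n}) :
  #|[pred p : config * config | swap_on S p.1 p.2 == p.1]| =
  (d ^ n * d ^ (n - #|S|))%N.
Proof.
transitivity (\sum_(x : config) \sum_(y : config | swap_on S x y == x) 1)%N.
  by rewrite pair_big_dep -sum1_card; apply: eq_bigl => -[x y].
transitivity (\sum_(x : config) d ^ (n - #|S|))%N; last first.
  by rewrite sum_nat_const card_ffun !card_ord.
apply: eq_bigr => x _; rewrite sum1_card.
pose F (i : 'I_n) := if i \in S then pred1 (x i) else predT.
rewrite (eq_card (_ : _ =i family F)) => [|y]; last first.
  apply/swap_onP/familyP => [xy i|xy i iS].
    by rewrite /F; case: ifP => // /xy /eqP.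
  by have := xy i; rewrite /F iS => /eqP.
rewrite card_family foldrE big_map big_enum /=.
rewrite (eq_bigr (fun i => if i \in ~: S then d else 1%N)) => [|i _].
  by rewrite -big_mkcond prod_nat_const cardsCs finset.setCK card_ord.
by rewrite /F finset.in_setC; case: (i \in S); rewrite ?card1 // cardT size_enum_ord.
Qed.

(** Each pair that agrees on [S] or off [S] contributes exactly 1, and [card_agree] counts both
    kinds. *)
Lemma swap_sum_flat_le (f : config -> C) (S : {set 'I_n}) :
  (forall x, `|f x| = 1) ->
  \sum_p swap_term f S p <=
  (d ^ n * d ^ (n - #|S|))%:R + (d ^ n * d ^ #|S|)%:R + `|offdiag f S|.
Proof.
move=> f1; have ffC x : f x * (f x)^* = 1 by rewrite -normCK f1 expr1n.
rewrite (bigID (generic_pair S)) /= [leRHS]addrC -/(offdiag f S) lerD //.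
  (* To be bounded by its norm, the off-diagonal sum must be real: exchanging the [S]-parts permutes
     the generic pairs and conjugates each term. *)
  apply: real_ler_norm; apply/CrealP.
  pose h (p : config * config) := (swap_on S p.1 p.2, swap_on S p.2 p.1).
  have hK : involutive h.
    move=> [x y]; rewrite /h /=; congr (_, _); apply/ffunP => i;
    by rewrite !ffunE; case: (i \in S).
  have gh p : generic_pair S (h p) = generic_pair S p.
    have := hK p; case: p => x y; rewrite /generic_pair /h /= => -[-> _].
    congr (_ && _); first by rewrite eq_sym.
    apply/negb_inj; rewrite !negbK; apply/eqP/eqP => [xE|yE].
      by apply/ffunP => i; have := congr1 (fun z : config => z i) xE;
         rewrite !ffunE; case: (i \in S).
    by apply/ffunP => i; have := congr1 (fun z : config => z i) yE;
       rewrite !ffunE; case: (i \in S).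
  rewrite /offdiag rmorph_sum [RHS](reindex_inj (inv_inj hK)) /=.
  apply: eq_big => [p|[x y] _]; first by rewrite gh.
  have [hx hy] : swap_on S (swap_on S x y) (swap_on S y x) = x /\
      swap_on S (swap_on S y x) (swap_on S x y) = y.
    by have [] := hK (x, y).
  by rewrite /swap_term /= hx hy !rmorphM /= !conjCK; ring.
apply: (@le_trans _ _ (\sum_(p | ~~ generic_pair S p) 1%:R)).
  apply: ler_sum => -[x y]; rewrite /generic_pair negb_and !negbK /swap_term /=.
  case/orP => /eqP xy.
    have -> : swap_on S y x = y.
      by apply/eqP/swap_onP => i iS; move/eqP/swap_onP: xy => ->.
    by rewrite xy -mulrA mulrACA !ffC mulr1.
  have -> : swap_on S y x = x.
    apply/eqP; rewrite swap_onC; apply/swap_onP => i iS.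
    by move/eqP: xy; rewrite swap_onC => /swap_onP ->.
  by rewrite xy -mulrA [_^* * _]mulrC mulrACA !ffC mulr1.
rewrite -natr_sum -natrD ler_nat sum1_card.
have <- := card_agree S; have <- : #|[pred p : config * config | swap_on S p.1 p.2 == p.2]| =
    (d ^ n * d ^ #|S|)%N.
  rewrite -[#|S| in RHS](_ : (n - #|~: S|)%N = _) -?card_agree; last first.
    by rewrite cardsCs finset.setCK card_ord subKn // -[leqRHS](card_ord n) max_card.
  rewrite -!sum1_card (reindex_inj (inv_inj (_ : involutive (fun p : config * config => (p.2, p.1))))) /=.
    by apply: eq_bigl => -[x y]; rewrite !inE /= swap_onC.
  by case.
rewrite -cardUI -[leqLHS]addn0 leq_add // subset_leq_card //.
apply/fintype.subsetP => p; rewrite !inE /generic_pair unfold_in.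
by rewrite negb_and !negbK.
Qed.

End FlatSum.

(** * The swap formula and approximate uniformity of flat states *)

Section PartialTrace.
Variables (R : realType) (d n : nat).
Local Notation C := (R[i]).
Implicit Types (S : {set 'I_n}) (x y : config d n) (psi : 'cV[C]_#|config d n|).

Definition amplitude psi x : C := psi (enum_rank x) ord0.

Lemma restr_eqP S x y :
  reflect {in S, forall i, x i = y i} (restr S x == restr S y).
Proof.
apply: (iffP eqP) => [/ffunP xy i iS | xy].
  by have := xy (exist _ i iS); rewrite !ffunE.
by apply/ffunP => -[i iS]; rewrite !ffunE; apply: xy.
Qed.

Lemma swap_on_eq S x x' y :
  ((restr (~: S) x == restr (~: S) y) && (restr S y == restr S x')) =
  (y == swap_on S x x').
Proof.
apply/andP/eqP => [[/restr_eqP xy /restr_eqP yx'] | ->]; last first.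
  split; apply/restr_eqP => i; rewrite ?finset.in_setC ffunE; last by move->.
  by move/negPf->.
apply/ffunP => i; rewrite ffunE; case: ifPn => [/yx' //|iS].
by rewrite xy // finset.in_setC.
Qed.

(** The trace runs over pairs (x, y) and (x', y') that agree off [S], with y matching x' and y'
    matching x on [S]. This forces y and y' to be the two swaps of x and x'. *)
Lemma purityE psi S :
  \tr (partial_trace S (density psi) *m partial_trace S (density psi)) =
  \sum_p swap_term (amplitude psi) S p.
Proof.
set rhoS := partial_trace _ _.
pose r x := enum_rank (restr S x).
pose same (p : config d n * config d n) := restr (~: S) p.1 == restr (~: S) p.2.
pose t (p : config d n * config d n) := amplitude psi p.1 * (amplitude psi p.2)^*.
have rhoE A B : rhoS A B =
    \sum_(p | same p && ((r p.1, r p.2) == (A, B))) t p.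
  rewrite mxE pair_big_dep /=; apply: eq_big => [[x y]|[x y] _] /=.
    rewrite /same /r xpair_eqE /= !(can2_eq enum_rankK enum_valK).
    by rewrite andbA andbC.
  by rewrite /density !mxE big_ord1 !mxE.
have -> : \tr (rhoS *m rhoS) = \sum_(p | same p) t p * rhoS (r p.2) (r p.1).
  rewrite [RHS](partition_big (fun p => (r p.1, r p.2)) xpredT) //=.
  rewrite /mxtrace -(pair_bigA _ (fun A B => \sum_(p | same p && ((r p.1, r p.2) == (A, B)))
    t p * rhoS (r p.2) (r p.1))) /=.
  apply: eq_bigr => A _; rewrite mxE; apply: eq_bigr => B _.
  rewrite {1}rhoE mulr_suml; apply: eq_bigr => p /andP[_].
  by rewrite xpair_eqE => /andP[/eqP -> /eqP ->].
rewrite -(pair_big_dep xpredT (fun x y => same (x, y))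
  (fun x y => t (x, y) * rhoS (r y) (r x))) /=.
rewrite -(pair_bigA _ (fun x x' => swap_term (amplitude psi) S (x, x'))) /=.
apply: eq_bigr => x _.
under eq_bigr => y _.
  rewrite rhoE -(pair_big_dep xpredT
    (fun x' y' => same (x', y') && ((r x', r y') == (r y, r x)))
    (fun x' y' => t (x', y'))) mulr_sumr /=.
  over.
rewrite (exchange_big_dep xpredT) //=; apply: eq_bigr => x' _.
under eq_bigr => y _.
  rewrite mulr_sumr.
  over.
rewrite pair_big_dep /= (big_pred1 (swap_on S x x', swap_on S x' x)).
  rewrite /t /swap_term /= mulrACA; ring.
move=> [y y'] /=; rewrite !xpair_eqE -!swap_on_eq /same /=.
rewrite /r !(inj_eq enum_rank_inj) [restr S x' == _]eq_sym andbT -!andbA.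
by congr (_ && _); rewrite andbCA.
Qed.
Lemma purity_flat_le (f : config d n -> C) (c : C) psi S :
  (0 < d)%N -> (forall x, `|f x| = 1) -> (forall x, amplitude psi x = c * f x) ->
  `|c| ^+ 2 = ((d ^ n)%:R)^-1 ->
  \tr (partial_trace S (density psi) *m partial_trace S (density psi)) <=
    ((d ^ #|S|)%:R)^-1 + ((d ^ (n - #|S|))%:R)^-1 +
    ((d ^ n)%:R) ^- 2 * `|offdiag f S|.
Proof.
move=> d_gt0 f1 psiE c2; rewrite purityE.
have dn0 m : (d ^ m)%:R != 0 :> C by rewrite pnatr_eq0 expn_eq0 gtn_eqF.
have -> : \sum_p swap_term (amplitude psi) S p =
    (d ^ n)%:R ^- 2 * \sum_p swap_term f S p.
  rewrite mulr_sumr; apply: eq_bigr => p _.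
  rewrite /swap_term !psiE !rmorphM -exprVn -c2 normCK /=; ring.
apply: le_trans (ler_wpM2l _ (swap_sum_flat_le S f1)) _.
  by rewrite invr_ge0 exprn_ge0 ?ler0n.
have Sn : (#|S| <= n)%N by rewrite -[leqRHS](card_ord n) max_card.
have dE : (d ^ n)%:R = (d ^ #|S|)%:R * (d ^ (n - #|S|))%:R :> C.
  by rewrite -natrM -expnD subnKC.
rewrite mulrDr lerD2r !natrM dE le_eqVlt; apply/orP; left; apply/eqP.
by field; rewrite !dn0.
Qed.

Lemma pure_state_flat (f : config d n -> C) (c : C) psi :
  (0 < d)%N -> (forall x, `|f x| = 1) -> (forall x, amplitude psi x = c * f x) ->
  `|c| ^+ 2 = ((d ^ n)%:R)^-1 -> pure_state psi.
Proof.
move=> d_gt0 f1 psiE c2; apply/matrixP => i j; rewrite !mxE !ord1 eqxx.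
rewrite (reindex_onto enum_rank enum_val) /= => [|k _]; last by rewrite enum_valK.
rewrite (eq_bigr (fun=> ((d ^ n)%:R)^-1)) => [|x _].
  rewrite (eq_bigl xpredT) => [|x]; last by rewrite enum_rankK eqxx.
  by rewrite sumr_const card_ffun !card_ord -[LHS]mulr_natl mulfV // pnatr_eq0 expn_eq0 gtn_eqF.
rewrite !mxE -/(amplitude psi x) psiE mulrC -normCK normrM f1 mulr1 c2 //.
Qed.

(** With D = d^n, the hypothesis reads 4 D^(-1/2) <= eps^2. The two excess terms are at most
    D^(-1/2), by 2k <= n, and sqrt(3) D^(-1/2), so each is below eps^2 / 2; the proof compares
    squares. *)
Lemma approx_uniform_flat (f : config d n -> C) (c : C) psi (eps : R) (k : nat) :
  (0 < d)%N -> (forall x, `|f x| = 1) -> (forall x, amplitude psi x = c * f x) ->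
  `|c| ^+ 2 = ((d ^ n)%:R)^-1 -> (k.*2 <= n)%N ->
  16 / (d ^ n)%:R <= eps ^+ 4 ->
  (forall S, `|offdiag f S| ^+ 2 <= 3 * (d ^ n)%:R ^+ 3) ->
  approx_uniform eps k psi.
Proof.
move=> d_gt0 f1 psiE c2 k2n eps4 off_le; split; first exact: pure_state_flat psiE c2.
move=> S Sk /=; apply: le_trans (purity_flat_le _ d_gt0 f1 psiE c2) _.
rewrite -addrA lerD2l; set e : C := (eps ^+ 2)%:C%C; rewrite Sk.
have e_ge0 : 0 <= e by rewrite lecR sqr_ge0.
have D_gt0 : 0 < (d ^ n)%:R :> C by rewrite ltr0n expn_gt0 d_gt0.
have e2 : 16 / (d ^ n)%:R <= e ^+ 2.
  have : (16 / (d ^ n)%:R)%:C%C <= (eps ^+ 4)%:C%C :> C by rewrite lecR.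
  rewrite rmorphM fmorphV /= !rmorph_nat => /le_trans; apply.
  by rewrite /e -rmorphXn -exprM.
have half_le : ((d ^ (n - k))%:R)^-1 <= e / 2.
  rewrite -(@ler_pXn2r _ 2) ?nnegrE ?invr_ge0 ?ler0n ?divr_ge0 //.
  rewrite expr_div_n ler_pdivlMr ?exprn_gt0 ?ltr0n //; apply: le_trans e2.
  rewrite -natrX mulrC ler_pM ?ler0n ?exprn_ge0 ?invr_ge0 ?ler0n ?ler_nat //.
  rewrite exprVn lef_pV2 ?posrE ?exprn_gt0 ?ltr0n ?expn_gt0 ?d_gt0 //.
  by rewrite -natrX ler_nat -expnM leq_pexp2l //; lia.
have off_half : (d ^ n)%:R ^- 2 * `|offdiag f S| <= e / 2.
  rewrite -(@ler_pXn2r _ 2) ?nnegrE ?mulr_ge0 ?invr_ge0 ?exprn_ge0 ?ler0n ?normr_ge0 ?divr_ge0 //.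
  rewrite exprMn (le_trans (ler_wpM2l _ (off_le S))) ?exprn_ge0 ?invr_ge0 ?ler0n //.
  have -> : (d ^ n)%:R ^- 2 ^+ 2 * (3 * (d ^ n)%:R ^+ 3) = 3 / (d ^ n)%:R :> C.
    by field; rewrite gt_eqF.
  rewrite expr_div_n ler_pdivlMr ?exprn_gt0 ?ltr0n //; apply: le_trans e2.
  rewrite mulrAC ler_pM2r ?invr_gt0 // -natrX -natrM ler_nat //.
by rewrite [leRHS]splitr lerD.
Qed.

End PartialTrace.

(** * The brickwork circuit *)

Section Content.
Variables (d n : nat) (rs : nat -> {ffun 'I_n.+1 -> 'I_d.+2}).
Local Notation window := {ffun 'I_n.+1 -> 'I_d.+2}.

Fixpoint register (k : nat) (x : window) : window :=
  if k is k'.+1 then shift (rs k') (register k' x) else x.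

(** The whole shift-register sequence as one function of position. *)
Definition stream (x : window) (m : nat) : 'I_d.+2 :=
  if (m <= n)%N then x (inord m) else register (m - n) x ord_max.

Lemma register_stream k x i : register k x i = stream x (k + i).
Proof.
elim: k i => [|k IHk] i; first by rewrite /stream -ltnS ltn_ord /= inord_val.
have [i_lt|] := ltnP i n.
  have ij : (inord i.+1 : 'I_n.+1) = i.+1 :> nat by rewrite inordK.
  by rewrite /= (shiftE _ _ ij) IHk ij addnS.
move=> n_le; have -> : i = ord_max by apply/val_inj/anti_leq; rewrite n_le -ltnS ltn_ord.
by rewrite /stream [nat_of_ord _]/= leqNgt addSn ltnS leq_addl -addSn addnK.
Qed.

(* The value carried by the [k]-th right-moving wire after it has crossed [p]
   left-moving ones. *)
Definition carried (x : window) (k p : nat) : 'I_d.+2 :=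
  stream x k + \sum_(i : 'I_n.+1 | (0 < i <= p)%N) rs k i * stream x (k + i).

Lemma carried0 x k : carried x k 0 = stream x k.
Proof. by rewrite /carried big1 ?addr0 // => i /andP[/leq_trans/[apply]]. Qed.

Lemma carriedS x k (p : 'I_n.+1) (q : nat) : p = q.+1 :> nat ->
  carried x k p = carried x k q + rs k p * stream x (k + p).
Proof.
move=> pq; rewrite /carried -addrA; congr (_ + _).
rewrite (bigD1 p) /= ?pq ?ltnSn // addrC; congr (_ + _).
by apply: eq_bigl => i; rewrite -val_eqE /= pq; lia.
Qed.

Lemma carried_max x k : carried x k n = feature (rs k) (register k x).
Proof.
rewrite /carried /feature !register_stream addn0; congr (_ + _).
apply: eq_big => [i|i _]; last by rewrite register_stream.
by rewrite -val_eqE /= -lt0n -(ltnS i n) ltn_ord andbT.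
Qed.

Lemma carried_stream x k : carried x k n = stream x (k + n.+1).
Proof.
rewrite carried_max -shift_max -[shift _ _]/(register k.+1 x) register_stream.
by rewrite addSnnS.
Qed.

(* In brick [t] the active bonds are the [p <= t] of the parity of [t]; the
   right-moving wire on bond [p] then performs step [(t - p) / 2] of the
   register. *)
Definition active (t p : nat) : bool := (p <= t)%N && (odd p == odd t).

Definition brick (t : nat) (x : window) : window :=
  [ffun p : 'I_n.+1 =>
    if (p < n)%N && active t p then x (inord p.+1)
    else if (0 < p)%N && active t p.-1 then
      x (inord p.-1) + rs (t - p.-1)./2 p * x p
    else x p].

(** The wires before brick [t]: sites beyond [t] are untouched, sites of the parity of [t] hold
    right-moving partial sums, and the others hold left-moving finished digits. *)
Definition content (t : nat) (x : window) : window :=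
  [ffun p : 'I_n.+1 =>
    if (t < p)%N then stream x p
    else if odd t == odd p then carried x (t - p)./2 p
    else stream x (t + p).+1./2].

Lemma content0 x : content 0 x = x.
Proof.
apply/ffunP => p; rewrite ffunE; case: posnP => [p0|_].
  by rewrite p0 /= carried0 -[0%N]/(0 + 0)%N -{2}p0 -register_stream.
by rewrite -[nat_of_ord p]add0n -register_stream.
Qed.

Lemma contentS t x : content t.+1 x = brick t (content t x).
Proof.
have val_inord m : (m <= n)%N -> (inord m : 'I_n.+1) = m :> nat.
  by move=> mn; rewrite inordK.
apply/ffunP => p; rewrite [RHS]ffunE; case: ifPn => [/andP[pn /andP[pt odd_pt]]|].
  rewrite !ffunE val_inord //.
  have -> : (t.+1 < p)%N = false by lia.
  have -> : (odd t.+1 == odd p) = false by move: odd_pt => /=; case: (odd t); case: (odd p).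
  have -> : (odd t == odd p.+1) = false by move: odd_pt => /=; case: (odd t); case: (odd p).
  by case: ltnP => tp; congr (stream _ _); lia.
rewrite negb_and => np; have pn : (p <= n)%N by rewrite -ltnS.
case: ifPn => [/andP[p_gt0 /andP[pt odd_pt]]|].
  have p1 : p.-1.+1 = p by rewrite prednK.
  rewrite !ffunE val_inord ?(leq_trans (leq_pred p)) //.
  have -> : (t.+1 < p)%N = false by lia.
  have odd_p : odd p = ~~ odd p.-1 by rewrite -{1}p1.
  have -> : (t < p.-1)%N = false by lia.
  have -> : (odd t.+1 == odd p) by rewrite odd_p /= (eqP odd_pt) eqxx.
  have -> : (odd t == odd p.-1) by rewrite eq_sym.
  have -> : (odd t == odd p) = false by rewrite odd_p (eqP odd_pt); case: odd.
  rewrite -{1}p1 subSS (carriedS x _ (esym p1)); congr (_ + _ * _).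
  have odd_half : ((t - p.-1)./2.*2 = t - p.-1)%N.
    by rewrite even_halfK // oddB // (eqP odd_pt) addbb.
  case: ltnP => tp; congr (stream _ _); last by lia.
  by have -> : (t - p.-1 = 0)%N by lia; rewrite add0n.
rewrite negb_and -leqNgt leqn0 => np'; rewrite !ffunE.
have [tp|pt] := ltnP t.+1 p; first by rewrite ltnW.
have odd_p : (0 < p)%N -> odd p = ~~ odd p.-1 by case: (p : nat).
have [p_t|t_p] := ltnP t p.
  have pE : p = t.+1 :> nat by lia.
  by move: np'; rewrite pE /= /active /= leqnn eqxx.
case: (boolP (odd t == odd p)) => odd_tp.
  (* At the right end a completed sum becomes a new digit of the stream and turns left. *)
  have pE : p = n :> nat.
    by move: np; rewrite /active t_p eq_sym odd_tp /= orbF; lia.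
  have -> : (odd t.+1 == odd p) = false by move: odd_tp => /=; case: (odd t); case: (odd p).
  rewrite pE carried_stream; congr (stream _ _).
  have : ((t - n)./2.*2 = t - n)%N.
    by rewrite even_halfK // oddB -?pE // (eqP odd_tp) addbb.
  by move: t_p; rewrite pE; lia.
have -> : (odd t.+1 == odd p) by move: odd_tp => /=; case: (odd t); case: (odd p).
(* At the left end an arriving digit turns right and starts a new sum. *)
have -> : p = 0%N :> nat.
  case: posnP np' => // p_gt0; rewrite /active.
  have -> : (p.-1 <= t)%N by lia.
  by move: odd_tp; rewrite odd_p //=; case: (odd t); case: (odd p.-1).
by rewrite subn0 addn0 carried0.
Qed.

End Content.

(** * Shear, phase and Fourier gates *)

Section Gates.
Variables (C : numClosedFieldType) (d : nat).

Definition unpair (i : 'I_(d.+2 * d.+2)) : 'I_d.+2 * 'I_d.+2 :=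
  enum_val (cast_ord (esym (mxvec_cast d.+2 d.+2)) i).

Lemma unpairK u v : unpair (mxvec_index u v) = (u, v).
Proof. by rewrite /unpair /mxvec_index cast_ordK enum_rankK. Qed.

Lemma unpair_inj : injective unpair.
Proof. by move=> i j /enum_val_inj/cast_ord_inj. Qed.

(** The right-moving [u] passes the left-moving [v] and picks up [c * v]; this is a bijection even
    if [c] is not invertible. *)
Definition shear (c : 'I_d.+2) (uv : 'I_d.+2 * 'I_d.+2) : 'I_d.+2 * 'I_d.+2 :=
  (uv.2, uv.1 + c * uv.2).

Lemma shear_inj c : injective (shear c).
Proof. move=> [u v] [u' v'] /eqP; rewrite xpair_eqE /= => /andP[/eqP ->].
by rewrite (inj_eq (@addIr _ _)) => /eqP ->. Qed.

(** Row [i] has its 1 in the column of the image of [i], so the gate pulls amplitudes back along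
    [shear c]. *)
Definition shear_mx (c : 'I_d.+2) : 'M[C]_(d.+2 * d.+2) :=
  \matrix_(i, j) (unpair j == shear c (unpair i))%:R.

Lemma shear_mx_unitary c : shear_mx c \is unitarymx.
Proof.
apply/unitarymxP/matrixP => i k; rewrite !mxE.
pose j := mxvec_index (shear c (unpair i)).1 (shear c (unpair i)).2.
have jE : unpair j = shear c (unpair i) by rewrite unpairK -surjective_pairing.
rewrite (bigD1 j) //= big1 => [|j' j'j].
  rewrite !mxE jE eqxx mul1r addr0 rmorph_nat (inj_eq (@shear_inj c)).
  by rewrite (inj_eq unpair_inj).
by rewrite !mxE -jE (inj_eq unpair_inj) (negPf j'j) mul0r.
Qed.

Definition phase_mx (ph : 'I_d.+2 -> C) : 'M[C]_d.+2 := diag_mx (\row_j ph j).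

Lemma phase_mx_unitary (ph : 'I_d.+2 -> C) :
  (forall j, `|ph j| = 1) -> phase_mx ph \is unitarymx.
Proof.
move=> ph1; apply/unitarymxP/matrixP => i k; rewrite !mxE.
rewrite (bigD1 i) //= big1 => [|j ji]; last first.
  by rewrite !mxE [i == j]eq_sym (negPf ji) mulr0n mul0r.
rewrite !mxE eqxx mulr1n addr0 [k == i]eq_sym; case: eqP => [<-|_].
  by rewrite mulr1n -normCK ph1 expr1n.
by rewrite mulr0n rmorph0 mulr0.
Qed.

Definition fourier_mx (w : C) : 'M[C]_d.+2 :=
  \matrix_(i, j) ((sqrtC d.+2%:R)^-1 * w ^+ (i * j)).

Lemma fourier_mx_unitary (w : C) :
  d.+2.-primitive_root w -> fourier_mx w \is unitarymx.
Proof.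
move=> wP; apply/unitarymxP/matrixP => i k; rewrite !mxE.
have w0 : w != 0 by rewrite (prim_root_eq0 wP).
have sq : (sqrtC d.+2%:R)^-1 * (sqrtC d.+2%:R)^-1 = d.+2%:R^-1 :> C.
  by rewrite -invfM -expr2 sqrtCK.
have sqC : ((sqrtC d.+2%:R)^-1)^* = (sqrtC d.+2%:R)^-1 :> C.
  by apply/CrealP; rewrite ger0_real // invr_ge0 sqrtC_ge0 ler0n.
pose z := w ^+ i / w ^+ k.
have zd : z ^+ d.+2 = 1.
  by rewrite expr_div_n -!exprM ![(_ * d.+2)%N]mulnC !exprM (prim_expr_order wP) !expr1n divr1.
rewrite (eq_bigr (fun j : 'I_d.+2 => d.+2%:R^-1 * z ^+ j)) => [|j _]; last first.
  rewrite !mxE rmorphM /= sqC mulrACA sq rmorphXn /= (prim_root_conj wP).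
  by rewrite /z expr_div_n -!exprM exprVn.
rewrite -mulr_sumr; have [ik|ik] := eqVneq i k.
  rewrite /z ik divff ?expf_neq0 // (eq_bigr (fun=> 1)) => [|j _]; last by rewrite expr1n.
  by rewrite sumr_const card_ord mulVf ?pnatr_eq0.
(* The successor [j + 1] wraps around at [d.+2], consistently with [z ^+ d.+2 = 1]. *)
rewrite (@sum_eigen0 _ _ (fun j : 'I_d.+2 => j + 1) z) ?mulr0 //.
- exact: addIr.
- rewrite -subr_eq0 -(inj_eq (mulIf (expf_neq0 k w0))) mul0r mulrBl divfK ?expf_neq0 //.
  rewrite mul1r subr_eq0 (eq_prim_root_expr wP) !modn_small //.
- by move=> j; rewrite -exprS /= addn1 (expr_mod _ zd).
Qed.

End Gates.

(** * Action of the layers on amplitudes *)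

Section Layers.
Variables (R : realType) (d n : nat).
Local Notation C := (R[i]).
Local Notation window := {ffun 'I_n.+1 -> 'I_d.+2}.

Lemma amplitude_layer (l : layer R d.+2 n.+1) psi (x : window) :
  amplitude (layer_mx l *m psi) x =
  \sum_(y : window)
    ((\prod_(b in lbonds l)
       lgate2 l b (mxvec_index (x (bond_left b)) (x (bond_right b)))
                  (mxvec_index (y (bond_left b)) (y (bond_right b)))) *
    \prod_(i | i \notin (\bigcup_(b in lbonds l) bond b)%SET)
       lgate1 l i (x i) (y i)) * amplitude psi y.
Proof.
rewrite /amplitude mxE (reindex_onto enum_rank enum_val) /=; last first.
  by move=> k _; rewrite enum_valK.
apply: eq_big => [y|y _]; first by rewrite enum_rankK eqxx.
by rewrite mxE !enum_rankK.
Qed.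

Lemma in_bond (b : 'I_n) (p : 'I_n.+1) :
  (p \in @bond n.+1 b) = (p == b :> nat) || (p == b.+1 :> nat).
Proof. by rewrite !inE -!val_eqE. Qed.

Section Fourier.
Variable w : C.
Hypothesis wP : d.+2.-primitive_root w.

Definition fourier_layer : layer R d.+2 n.+1 :=
  Layer (@layer1_bonds n.+1) (fun=> unitarymx1 _ _)
    (fun=> fourier_mx_unitary wP).

Lemma amplitude_fourier_layer (x : window) :
  amplitude (layer_mx fourier_layer *m ket0 R d.+2 n.+1) x =
  (sqrtC d.+2%:R)^-1 ^+ n.+1.
Proof.
rewrite amplitude_layer (bigD1 [ffun=> ord0]) //= [X in _ + X]big1 ?addr0.
  rewrite /amplitude mxE enum_rankK.
  have -> : [forall i, ([ffun=> ord0] : window) i == 0%N :> nat].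
    by apply/forallP => i; rewrite ffunE.
  rewrite mulr1 !big_set0 mul1r (eq_bigr (fun=> (sqrtC d.+2%:R)^-1)) => [|i _].
    rewrite (eq_bigl xpredT) => [|i]; last by rewrite finset.in_set0.
    by rewrite prodr_const card_ord.
  by rewrite mxE ffunE muln0 expr0 mulr1.
move=> y y0.
rewrite /amplitude mxE enum_rankK; case: forallP => [y0'|]; last by rewrite mulr0.
case/eqP: y0; apply/ffunP => i; rewrite ffunE; apply/val_inj/eqP.
exact: y0'.
Qed.

End Fourier.

Section Brick.
Variables (rs : nat -> window) (t : nat) (ph : 'I_d.+2 -> C).
Hypothesis ph1 : forall j, `|ph j| = 1.
Hypothesis ph_idle : ~~ active t n -> forall j, ph j = 1.

Lemma brick_bonds : {in [set b : 'I_n | active t b]%SET &,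
  forall b b', b != b' -> [disjoint @bond n.+1 b & @bond n.+1 b']}.
Proof.
move=> b b'; rewrite !inE => /andP[_ /eqP bt] /andP[_ /eqP b't] bb'.
apply/pred0P => p /=; rewrite !in_bond; apply: contraNF bb'.
rewrite -val_eqE /= => /andP[/orP[]/eqP -> /orP[]/eqP E].
- by rewrite E.
- by move: bt; rewrite E /= b't; case: (odd t).
- by move: b't; rewrite -E /= bt; case: (odd t).
- by case: E => ->.
Qed.

Lemma phase_gate_unitary (i : 'I_n.+1) :
  (if i == ord_max then phase_mx ph else 1%:M) \is unitarymx.
Proof. by case: ifP => _; [exact: phase_mx_unitary | exact: unitarymx1]. Qed.

Definition brick_layer : layer R d.+2 n.+1 :=
  @Layer R d.+2 n.+1 _ _ _ brick_bonds
    (fun b : 'I_n => shear_mx_unitary _ (rs (t - b)./2 (@bond_right n.+1 b)))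
    phase_gate_unitary.

(** Each row of each gate has a single nonzero entry, so only the configuration [brick rs t x]
    contributes. *)
Lemma amplitude_brick_layer psi (x : window) :
  amplitude (layer_mx brick_layer *m psi) x =
  ph (x ord_max) * amplitude psi (brick rs t x).
Proof.
have leftE (b : 'I_n) : (inord b.+1 : 'I_n.+1) = @bond_right n.+1 b.
  by apply/val_inj; rewrite /= inordK // ltnS.
have coveredE (p : 'I_n.+1) :
    (p \in (\bigcup_(b in lbonds brick_layer) bond b)%SET) =
    ((p < n)%N && active t p) || ((0 < p)%N && active t p.-1).
  apply/finset.bigcupP/orP => [[b]|].
    rewrite in_bond inE => tb /orP[]/eqP ->; [left|right].
      by rewrite ltn_ord tb.
    by rewrite /= tb.
  case=> /andP[pn tp].
    by exists (Ordinal pn); rewrite ?in_bond ?eqxx // inE.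
  have p1 : (p.-1 < n)%N by rewrite -ltnS prednK.
  by exists (Ordinal p1); [rewrite inE | rewrite in_bond /= prednK // eqxx orbT].
have brick_left (b : 'I_n) : active t b ->
    brick rs t x (@bond_left n.+1 b) = x (@bond_right n.+1 b).
  by move=> tb; rewrite ffunE /= ltn_ord tb leftE.
have brick_right (b : 'I_n) : active t b ->
    brick rs t x (@bond_right n.+1 b) = x (@bond_left n.+1 b) +
      rs (t - b)./2 (@bond_right n.+1 b) * x (@bond_right n.+1 b).
  move=> tb; rewrite ffunE /= tb.
  have -> : active t b.+1 = false.
    by move: tb; rewrite /active => /andP[_ /eqP <-] /=; case: odd; rewrite andbF.
  rewrite andbF; congr (x _ + _); apply/val_inj; rewrite /= inordK //.
  by rewrite ltnW // ltnS.
rewrite amplitude_layer (bigD1 (brick rs t x)) //= [X in _ + X]big1 ?addr0.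
  congr (_ * _); rewrite big1 ?mul1r => [|b]; last first.
    rewrite inE => tb; rewrite mxE !unpairK /shear /= brick_left // brick_right //.
    by rewrite eqxx.
  have gateE (p : 'I_n.+1) : p \notin (\bigcup_(b in lbonds brick_layer) bond b)%SET ->
      (if p == ord_max then phase_mx ph else 1%:M) (x p) (brick rs t x p) =
      if p == ord_max then ph (x ord_max) else 1.
    rewrite coveredE negb_or => /andP[/negPf pl /negPf pr].
    rewrite ffunE pl pr; case: eqP => [->|_]; first by rewrite !mxE eqxx.
    by rewrite !mxE eqxx.
  rewrite (eq_bigr _ gateE) -big_mkcondr /=.
  (* When [active t n] holds, bond [n.-1] has the wrong parity and leaves the last site free for the
     phase gate; at other times [ph] is 1. *)
  have [tn|tn] := boolP (active t n).
    rewrite (big_pred1 ord_max) // => p; rewrite -andbC coveredE /=.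
    case: (eqVneq p ord_max) => // ->; rewrite /= ltnn /=; case: n tn => // n'.
    by rewrite /active => /andP[_ /eqP <-] /=; case: odd; rewrite andbF.
  by rewrite big1 ?ph_idle // => p _; rewrite ph_idle.
move=> y yx; apply/eqP; rewrite mulf_eq0; apply/orP; left.
have /existsP[p yp] : [exists p, y p != brick rs t x p].
  apply: contraR yx; rewrite negb_exists => /forallP yE.
  by apply/eqP/ffunP => p; have := yE p; rewrite negbK => /eqP.
rewrite mulf_eq0; case: (boolP (p \in (\bigcup_(b in lbonds brick_layer) bond b)%SET)).
  case/finset.bigcupP => b tb pb; apply/orP; left; rewrite prodf_seq_eq0.
  apply/hasP; exists b; first exact: mem_index_enum.
  rewrite tb mxE !unpairK /shear /= xpair_eqE pnatr_eq0 eqb0.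
  move: tb; rewrite inE => tb; apply: contra yp => /andP[/eqP yl /eqP yr].
  move: pb; rewrite /bond !inE => /orP[]/eqP ->.
    by rewrite yl brick_left.
  by rewrite yr brick_right.
move=> p_nc; apply/orP; right; rewrite prodf_seq_eq0; apply/hasP.
exists p; first exact: mem_index_enum.
rewrite p_nc /=; move: p_nc yp; rewrite coveredE negb_or => /andP[/negPf pl /negPf pr].
rewrite ffunE pl pr eq_sym => /negPf yp.
by case: ifP => _; rewrite !mxE yp mulr0n.
Qed.

End Brick.
End Layers.

(** * The circuit that prepares a phase state *)

Section PhaseCircuit.
Variables (R : realType) (d n : nat).
Local Notation C := (R[i]).
Local Notation window := {ffun 'I_n.+1 -> 'I_d.+2}.
Local Notation phases := {ffun 'I_d.+2 -> 'I_5}.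
Variables (zeta w : C).
Hypothesis zetaP : 5.-primitive_root zeta.
Hypothesis wP : d.+2.-primitive_root w.

Let x0 : window * phases := ([ffun=> ord0], [ffun=> ord0]).

Definition step_coef (s : seq (window * phases)) (k : nat) : window :=
  (nth x0 s k).1.

Lemma register_shift (rs : nat -> window) k x :
  register rs k.+1 x = register (fun j => rs j.+1) k (shift (rs 0%N) x).
Proof. by elim: k => [|k IHk] //; rewrite [LHS]/= -/(register rs k.+1 x) IHk. Qed.

Lemma phase_register s x :
  phase zeta s x = \prod_(k < size s)
    zeta ^+ (nth x0 s k).2 (feature (step_coef s k) (register (step_coef s) k x)).
Proof.
elim: s x => [|[r g] s IHs] x; first by rewrite big_ord0.
rewrite /= big_ord_recl /= IHs; congr (_ * _); apply: eq_bigr => k _.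
by rewrite -[shift _ (register _ _ _)]/(register (step_coef ((r, g) :: s)) k.+1 x)
  register_shift.
Qed.

(** The feature of step [k] is complete on the last site at time [k.*2 + n]; these are exactly the
    times at which [active t n] holds. *)
Definition layer_phase (s : seq (window * phases)) (t : nat) (j : 'I_d.+2) : C :=
  if active t n then zeta ^+ (nth x0 s (t - n)./2).2 j else 1.

Lemma norm_layer_phase s t j : `|layer_phase s t j| = 1.
Proof. by rewrite /layer_phase; case: ifP; rewrite ?normr1 ?norm_zetaX. Qed.

Lemma layer_phase_idle s t : ~~ active t n -> forall j, layer_phase s t j = 1.
Proof. by rewrite /layer_phase => /negPf ->. Qed.

Lemma prod_active (F : nat -> C) N :
  (forall t, ~~ active t n -> F t = 1) ->
  \prod_(0 <= t < N.*2 + n) F t = \prod_(k < N) F (k.*2 + n)%N.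
Proof.
move=> F1; elim: N => [|N IHN].
  rewrite big_ord0 big_nat big1 // => t /= tn; apply: F1.
  by rewrite /active leqNgt tn.
rewrite big_ord_recr -IHN doubleS !addSn !big_nat_recr //= [F _.+1]F1 ?mulr1 //.
by rewrite /active /= oddD odd_double /=; case: odd; rewrite andbF.
Qed.

Lemma prod_layer_phase s x :
  \prod_(0 <= t < (size s).*2 + n)
    layer_phase s t (content (step_coef s) t x ord_max) = phase zeta s x.
Proof.
rewrite prod_active => [|t /layer_phase_idle -> //].
rewrite phase_register; apply: eq_bigr => k _.
rewrite /layer_phase /active leq_addl oddD odd_double eqxx /= addnK doubleK.
rewrite ffunE /= ltnNge leq_addl /= oddD odd_double eqxx addnK doubleK.
by rewrite carried_max.
Qed.

Definition phase_layer s t : layer R d.+2 n.+1 :=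
  brick_layer (step_coef s) t (norm_layer_phase s t).

(* A layer acts on amplitudes by pulling back along [brick t], so time runs
   against the circuit: the layer of time [0] is applied last. *)
Lemma exists_phase_circuit (s : seq (window * phases)) :
  exists c : circuit R d.+2 n.+1 (2 * size s + n.+1),
    forall x, amplitude (circuit_mx c *m ket0 R d.+2 n.+1) x =
      (sqrtC d.+2%:R)^-1 ^+ n.+1 * phase zeta s x.
Proof.
pose T := ((size s).*2 + n)%N.
pose ls := fourier_layer n wP :: rev (map (phase_layer s) (iota 0 T)).
have size_ls : size ls == (2 * size s + n.+1)%N.
  by rewrite /= size_rev size_map size_iota mul2n addnS.
exists (Tuple size_ls) => x.
rewrite /circuit_mx /= foldl_rev mulmx1.
set U0 := layer_mx (fourier_layer n wP).
pose run ts := foldr (fun l U => layer_mx l *m U) U0 (map (phase_layer s) ts).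
have runE t k : amplitude (run (iota t k) *m ket0 R d.+2 n.+1)
      (content (step_coef s) t x) =
    (\prod_(t <= i < t + k)
      layer_phase s i (content (step_coef s) i x ord_max)) *
    amplitude (U0 *m ket0 R d.+2 n.+1) (content (step_coef s) (t + k) x).
  elim: k t => [|k IHk] t; first by rewrite addn0 big_geq // mul1r.
  rewrite /run /= -mulmxA amplitude_brick_layer; last exact: layer_phase_idle.
  rewrite -contentS -/(run (iota t.+1 k)) IHk addSnnS mulrA.
  by rewrite [in RHS]big_ltn // addnS ltnS leq_addr.
have := runE 0%N T; rewrite content0 add0n /run => ->.
by rewrite prod_layer_phase amplitude_fourier_layer mulrC.
Qed.

End PhaseCircuit.

(** * Good circuits and the Dirac ensemble *)

Lemma exists_approx_uniform (R : realType) (d n k : nat) (eps : R) :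
  (2 <= d)%N -> (16 <= n)%N -> (k.*2 <= n)%N -> 16 / (d ^ n)%:R <= eps ^+ 4 ->
  exists c : circuit R d n (2 * (14 * d ^ 2 * n) + n),
    approx_uniform eps k (circuit_mx c *m ket0 R d n).
Proof.
case: d => [|[|d]] // _; case: n => // n n16 kn eps4.
have [zeta zetaP] := closed_prim_root_exists (R[i]) (isT : (0 < 5)%N).
have [w wP] := closed_prim_root_exists (R[i]) (ltn0Sn d.+1).
have [s <- s_off] := exists_small_offdiag d zetaP n16.
have [c cE] := exists_phase_circuit zetaP wP s.
exists c; apply: (approx_uniform_flat _ _ cE _ kn eps4 s_off) => //.
  by move=> x; apply: norm_phase.
have sq_ge0 : 0 <= (sqrtC d.+2%:R)^-1 :> R[i] by rewrite invr_ge0 sqrtC_ge0 ler0n.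
by rewrite normrX ger0_norm // -exprM mulnC exprM exprVn sqrtCK natrX exprVn.
Qed.

Local Open Scope classical_set_scope.
Local Open Scope ring_scope.

Theorem theorem4 (R : realType) (d : nat) (alpha : R) (eps : nat -> R) :
  (2 <= d)%N ->
  0 < alpha -> alpha < 2^-1 ->
  let A := [set n : nat | alpha * n%:R \is a Num.nat] in
  (forall n, A n -> 0 < eps n) ->
  eps n @[n --> within A \oo] --> (0 : R) ->
  eps n / (d%:R `^ (- ((1 - alpha) * n%:R / 2))) @[n --> within A \oo] --> +oo ->
  eps n / (d%:R `^ (- (n%:R / 4))) @[n --> within A \oo] --> +oo ->
  exists (L : nat -> nat) (nu : forall n : nat, ensemble R d n (L n)),
    (fun n => (L n)%:R : R) =O_ (within A \oo) (fun n => n%:R : R) /\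
    nu n [set c : circuit R d n (L n) |
           ~ approx_uniform (eps n) (Num.truncn (alpha * n%:R))
               (circuit_mx c *m ket0 R d n)] @[n --> within A \oo] --> 0%E.
Proof.
move=> d2 alpha0 alpha1 A _ _ _ eps_d.
pose L n := (2 * (14 * d ^ 2 * n) + n)%N.
pose good n := [set c : circuit R d n (L n) |
  approx_uniform (eps n) (Num.truncn (alpha * n%:R)) (circuit_mx c *m ket0 R d n)].
(* [xget] returns the default circuit when no good one exists; below, this is excluded for large [n]
   in [A]. *)
pose c n : circuit_space R d n (L n) := xget point (good n).
exists L, (fun n => dirac (c n)); split.
  apply/eqOP; near=> K; near=> n.
  rewrite !ger0_norm ?ler0n // /L.
  have -> : (2 * (14 * d ^ 2 * n) + n = (28 * d ^ 2 + 1) * n)%N by ring.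
  by rewrite natrM ler_wpM2r ?ler0n //; near: K; apply: nbhs_pinfty_ge; rewrite num_real.
(* The failure probability is eventually equal to 0. *)
apply: cvg_near_cst; near=> n.
rewrite /= diracE memNset //=; suff : good n (c n) by move=> gc; apply.
apply: xgetPex; apply: exists_approx_uniform => //.
- near: n; apply: cvg_within; exact: nbhs_infty_ge.
- have trunc_le : (Num.truncn (alpha * n%:R))%:R <= alpha * n%:R.
    by rewrite truncn_le mulr_ge0 // ltW.
  rewrite -(ler_nat R) -muln2 natrM; apply: le_trans (ler_wpM2r _ trunc_le) _ => //.
  by rewrite mulrAC ler_piMl ?ler0n // -ler_pdivlMr // div1r ltW.
have d_gt0 : 0 < d%:R :> R by rewrite ltr0n ltnW.
(* The threshold 2 is the fourth root of the constant 16 in the bound on [eps n ^+ 4]. *)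
have : 2 <= eps n / d%:R `^ (- (n%:R / 4)).
  by near: n; move/cvgryPge : eps_d; apply.
rewrite ler_pdivlMr ?powR_gt0 // => le_eps.
have pow_ge0 : 0 <= 2 * d%:R `^ (- (n%:R / 4)) :> R by rewrite mulr_ge0 ?powR_ge0.
apply: le_trans (lerXn2r 4 _ _ le_eps); rewrite ?nnegrE ?(le_trans pow_ge0) //.
rewrite exprMn -[X in _ <= _ * X]powR_mulrn ?powR_ge0 // -powRrM mulNr divfK //.
rewrite powRN powR_mulrn ?ler0n // -natrX ler_wpM2r ?invr_ge0 ?ler0n //.
by rewrite -natrX ler_nat.
Unshelve. all: by end_near.
Qed.
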